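(* Let $X$ be a real Banach space with infratype $p>1$ with a constant $C>0$, and let $F:[0,1]\to\mathrm{b}(X)$ be a multifunction such that $\operatorname{conv}F$ is Riemann integrable with $\int_0^1\operatorname{conv}F(t)\,dt=A$. Then $F$ is Riemann integrable and $\int_0^1F(t)\,dt=A$.
   Context: A Banach space $X$ is of infratype $p$ with a constant $C>0$ if for every finite collection $x_1,\dots,x_n\in X$ one has $\min_{\alpha_i=\pm1}\left\|\sum_{i=1}^n\alpha_i x_i\right\|\le C\left(\sum_{i=1}^n\|x_i\|^p\right)^{1/p}$. Let $\mathrm{b}(X)$ be the collection of all non-empty bounded subsets of $X$ and $\mathrm{clb}(X)$ the subcollection of closed ones. A multifunction $F:[0,1]\to\mathrm{b}(X)$ is a map assigning to each $t\in[0,1]$ a non-empty bounded set $F(t)\subset X$. $\operatorname{conv}F$ is the multifunction $t\mapsto\operatorname{conv}(F(t))$ (ordinary convex hull, no closure taken). For $A,B\subset X$ and a scalar $\lambda$: $A+B=\{a+b: a\in A, b\in B\}$ (Minkowski sum), $\lambda A=\{\lambda a: a\in A\}$. The Hausdorff distance (a pseudometric on $\mathrm{b}(X)$) is $\rho_H(A,B)=\max\{\sup_{b\in B}\rho(b,A),\ \sup_{a\in A}\rho(a,B)\}$, where $\rho(x,A)=\inf_{a\in A}\|x-a\|$. A tagged partition $T=\{\Delta_i,t_i\}_{i=1}^n$ of $[0,1]$ consists of a partition of $[0,1]$ into consecutive intervals $\Delta_i=[x_{i-1},x_i]$, $0=x_0<\dots<x_n=1$, and points $t_i\in\Delta_i$;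 $d(T)=\max_i|\Delta_i|$, where $|\Delta_i|$ is the length. The Riemann sum is $S(F,T)=\sum_{i=1}^n|\Delta_i|F(t_i)$. $F$ is Riemann integrable if there is a set $A\in\mathrm{clb}(X)$ (then unique, called the Riemann integral $\int_0^1F(t)\,dt$) such that for every $\varepsilon>0$ there is $\delta>0$ with $\rho_H(S(F,T),A)<\varepsilon$ for every tagged partition $T$ with $d(T)<\delta$. *)

(* Defs.v *)
From HB Require Import structures.
From mathcomp Require Import all_boot all_order all_algebra.
From mathcomp Require Import all_classical all_reals all_analysis.
Set Implicit Arguments.
Unset Strict Implicit.
Unset Printing Implicit Defensive.
Import Order.TTheory GRing.Theory Num.Theory.
Import numFieldNormedType.Exports.
Local Open Scope classical_set_scope.
Local Open Scope ring_scope.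

(* The idle value of the big minimum is the member of the family whose signs
   are all +1, so the operator computes the minimum of the family itself. *)
Definition infratype (R : realType) (X : normedModType R) (p C : R) : Prop :=
  forall (n : nat) (x : 'I_n -> X),
    \big[Num.min/`|\sum_(i < n) x i|]_(a : {ffun 'I_n -> bool})
       `|\sum_(i < n) (-1) ^+ a i *: x i|
    <= C * (\sum_(i < n) `|x i| `^ p) `^ p^-1.

Definition in_b (R : realType) (X : normedModType R) (A : set X) : Prop :=
  A !=set0 /\ bounded_set A.

Definition in_clb (R : realType) (X : normedModType R) (A : set X) : Prop :=
  in_b A /\ closed A.

Definition conv_hull (R : realType) (X : lmodType R) (A : set X) : set X :=
  smallest (@convex_set R X) A.

Definition minkowski_add (X : zmodType) (A B : set X) : set X :=
  [set a + b | a in A & b in B].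

Definition set_scale (R : realType) (X : lmodType R) (l : R) (A : set X) :
    set X :=
  [set l *: a | a in A].

(* The real-valued inf and sup below are the intended ones on non-empty bounded
   sets; elsewhere the library gives them default values. *)
Definition dist_set (R : realType) (X : normedModType R) (x : X) (A : set X) :
    R :=
  inf [set `|x - a| | a in A].

Definition hausdorff (R : realType) (X : normedModType R) (A B : set X) : R :=
  Num.max (sup [set dist_set b A | b in B]) (sup [set dist_set a B | a in A]).

(* As for itv_partition, the list of division points omits x_0 = 0:
   tp_seq = [:: x_1; ...; x_n] with 0 < x_1 < ... < x_n = 1. *)
Definition tp_point (R : realType) (s : seq R) (i : nat) : R :=
  nth 0 (0 :: s) i.

(* The interval of index i : 'I_n is [x_i, x_(i+1)], numbered from 0. *)
Record tagged_partition (R : realType) := TaggedPartition {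
  tp_seq : seq R;
  tp_tag : 'I_(size tp_seq) -> R;
  tp_seqP : itv_partition 0 1 tp_seq;
  tp_tagP : forall i : 'I_(size tp_seq),
    tp_point tp_seq i <= tp_tag i <= tp_point tp_seq i.+1
}.

Definition tp_length (R : realType) (T : tagged_partition R)
    (i : 'I_(size (tp_seq T))) : R :=
  tp_point (tp_seq T) i.+1 - tp_point (tp_seq T) i.

Definition tp_mesh (R : realType) (T : tagged_partition R) : R :=
  \big[Num.max/0]_(i < size (tp_seq T)) tp_length i.

(* A multifunction on [0, 1] is represented by a map on R; only its values on
   [0, 1] are used, as all tags lie there. *)
Definition riemann_sum (R : realType) (X : normedModType R) (F : R -> set X)
    (T : tagged_partition R) : set X :=
  \big[@minkowski_add X/[set 0]]_(i < size (tp_seq T))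
     set_scale (tp_length i) (F (tp_tag i)).

(* F is Riemann integrable and its Riemann integral over [0, 1] is A. *)
Definition is_riemann_integral (R : realType) (X : normedModType R)
    (F : R -> set X) (A : set X) : Prop :=
  in_clb A /\
  forall e : R, 0 < e -> exists2 d : R, 0 < d &
    forall T : tagged_partition R, tp_mesh T < d ->
      hausdorff (riemann_sum F T) A < e.

(* Main.v *)
Require Import Defs.
From HB Require Import structures.
From mathcomp Require Import all_boot all_order all_algebra.
From mathcomp Require Import all_classical all_reals all_analysis.
From mathcomp Require Import ring lra.
Import Order.TTheory GRing.Theory Num.Theory.
Import numFieldNormedType.Exports.
Local Open Scope classical_set_scope.
Local Open Scope ring_scope.

(** The Riemann sums of [F] are subsets of those of [conv F], and the proof
    shows that the two lie within a Hausdorff distance that tends to [0]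
    with the mesh.

    The key is a rounding estimate in spaces of infratype [p > 1]
    ([round_conv_hull]): if the points of [B_j] have norm at most [r_j],
    then any sum of points of the convex hulls of the [B_j] is within [c *
    (sum_j r_j ^ p) ^ (1 / p) + e] of a sum of points of the [B_j] for every
    [e > 0], where [c] depends on [p] and [C] only. Points of a convex hull
    are limits of means of [2 ^ m] points of the set
    ([conv_hull_dyadic_means]). Group the points of these means into pairs
    [(u, v)]. Since [u] and [v] are [(u + v) / 2] plus or minus [(u - v) /
    2], choosing one member of each pair is a choice of signs, and infratype
    provides a choice that changes the total sum by little
    ([infratype_select]). Each such step halves the number of points in
    every mean and costs at most [C * q ^ m * (sum_j r_j ^ p) ^ (1 / p)]
    with [q = 2 ^ (1 / p) / 2 < 1] ([halving_ratio]), so that the total cost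
    is that of a geometric series ([round_dyadic]).

    The Riemann integrability of [conv F] forces [F] to be bounded, say by
    [K] ([riemann_sums_bounded]). In a Riemann sum over a partition of mesh
    [d] the radii are [r_i = K * |Delta_i|], and [sum_i r_i ^ p <= K ^ p * d
    ^ (p - 1)] tends to [0] with [d] ([tp_pnorm_le]). *)

(** * Choosing one point of each pair *)

(** The minimum over the signs is attained; the index set becomes an arbitrary
    finite type so that it can be a product later. *)
Lemma infratype_signs (R : realType) (X : normedModType R) (p C : R)
    (J : finType) (x : J -> X) : infratype X p C ->
  exists a : J -> bool,
    `|\sum_j (-1) ^+ a j *: x j| <= C * (\sum_j `|x j| `^ p) `^ p^-1.
Proof.
move=> /(_ #|J| (fun i => x (enum_val i))).
set m := \big[_/_]_(_ : _) _ => le_m.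
have [a Em] : exists a : {ffun 'I_#|J| -> bool},
    `|\sum_(i < #|J|) (-1) ^+ a i *: x (enum_val i)| = m.
  rewrite /m; elim/big_ind: _ => [|u v [a <-] [b <-]|a _]; last by exists a.
  - exists [ffun=> false]; congr `|_|.
    by apply: eq_bigr => i _; rewrite ffunE scale1r.
  - by case: leP => _; [exists a | exists b].
exists (fun j => a (enum_rank j)).
rewrite -Em in le_m.
suff -> : \sum_j (-1) ^+ a (enum_rank j) *: x j =
    \sum_(i < #|J|) (-1) ^+ a i *: x (enum_val i).
  suff -> : \sum_j `|x j| `^ p = \sum_(i < #|J|) `|x (enum_val i)| `^ p by [].
  by rewrite -(big_enum_val (fun j => `|x j| `^ p)).
rewrite [LHS](big_enum_val (A := predT)).
by apply: eq_bigr => i _; rewrite enum_valK.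
Qed.

(** [u j] and [v j] are their midpoint plus and minus [(u j - v j) / 2], so that
    a choice between them is a choice of a sign. *)
Lemma infratype_select (R : realType) (X : normedModType R) (p C : R)
    (J : finType) (u v : J -> X) : infratype X p C ->
  exists c : J -> bool,
    `|\sum_j (if c j then u j else v j) - 2^-1 *: \sum_j (u j + v j)|
    <= C * (\sum_j `|2^-1 *: (u j - v j)| `^ p) `^ p^-1.
Proof.
move=> /(infratype_signs R X p C J (fun j => 2^-1 *: (u j - v j)))[a le_a].
exists (fun j => ~~ a j); rewrite scaler_sumr -sumrB.
rewrite (eq_bigr (fun j => (-1) ^+ a j *: (2^-1 *: (u j - v j)))) // => j _.
have E (w : X) : w = 2^-1 *: w + 2^-1 *: w.
  by rewrite -scalerDl -[LHS]scale1r; congr (_ *: _); field.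
case: (a j) => /=; rewrite ?scaleN1r ?scale1r !(scalerDr, scalerN).
  by rewrite [X in X - _]E opprD opprB addrACA subrr addr0 addrC.
by rewrite [X in X - _]E opprD addrACA subrr add0r.
Qed.

(** * Rounding dyadic means *)

Lemma sum_pair (I J : finType) (V : nmodType) (f : I * J -> V) :
  \sum_z f z = \sum_i \sum_j f (i, j).
Proof. by rewrite pair_bigA; apply: eq_bigr => -[]. Qed.

(** Words of [m] bits; the recursive form makes the first bit, which groups the
    index set into pairs, available by pattern matching. *)
Fixpoint dyadic_index (m : nat) : finType :=
  if m is m'.+1 then (bool * dyadic_index m')%type : finType else unit.

Definition dyadic_mean {R : realType} {X : lmodType R} {m : nat}
    (a : dyadic_index m -> X) : X :=
  2^-1 ^+ m *: \sum_k a k.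

Lemma card_dyadic_index m : #|dyadic_index m| = (2 ^ m)%N.
Proof.
elim: m => [|m IHm] /=; first by rewrite card_unit.
by rewrite card_prod card_bool IHm expnS.
Qed.

Lemma sum_dyadic_index (V : zmodType) m (a : dyadic_index m.+1 -> V) :
  \sum_k a k = \sum_k (a (true, k) + a (false, k)).
Proof.
by rewrite sum_pair big_bool big_split.
Qed.

Lemma dyadic_meanS (R : realType) (X : lmodType R) m
    (a : dyadic_index m.+1 -> X) :
  dyadic_mean a = 2^-1 *: (dyadic_mean (fun k => a (true, k)) +
                           dyadic_mean (fun k => a (false, k))).
Proof.
by rewrite /dyadic_mean sum_dyadic_index big_split /= exprS -scalerA scalerDr.
Qed.

(** The factor between the errors of two successive halving steps. *)
Definition halving_ratio (R : realType) (p : R) : R := 2 `^ p^-1 / 2.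

Lemma halving_ratio_ge0 (R : realType) (p : R) : 0 <= halving_ratio R p.
Proof. by rewrite divr_ge0 ?powR_ge0. Qed.

Lemma halving_ratio_lt1 (R : realType) (p : R) : 1 < p -> halving_ratio R p < 1.
Proof.
move=> p_gt1; have p_gt0 : 0 < p by apply: lt_trans p_gt1.
rewrite ltr_pdivrMr// mul1r /powR pnatr_eq0/= -[ltRHS]lnK ?posrE//.
by rewrite ltr_expR gtr_pMl ?ln_gt0 ?ltr1n// invf_lt1.
Qed.

(** The total error of one halving step: [2 ^ m] choices for each set, each of
    size at most [2 ^ - m] times the radius of the set. *)
Lemma halving_ratio_expE (R : realType) (p r : R) m : 0 < p -> 0 <= r ->
  ((2 ^+ m * (2^-1 ^+ m) `^ p) * r) `^ p^-1 =
    halving_ratio R p ^+ m * r `^ p^-1.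
Proof.
move=> p_gt0 r0; rewrite !powRM ?mulr_ge0 ?powR_ge0 ?exprn_ge0//.
rewrite -powRrM mulfV ?gt_eqF// powRr1 ?exprn_ge0//.
by rewrite -powR_mulrn// powRAC powR_mulrn ?powR_ge0// -exprMn.
Qed.

(** One selection step replaces each pair of points at the top level of the
    means by one of its two members, for all sets and all pairs at once, and
    so turns means over [2 ^ (m + 1)] points into means over [2 ^ m] points.
    The errors form a geometric series as [m] decreases to [0], where a mean
    is a single point of the set. *)
Lemma round_dyadic (R : realType) (X : normedModType R) (p C : R)
    (J : finType) (B : J -> set X) (r : J -> R) m
    (a : J -> dyadic_index m -> X) :
  1 < p -> 0 < C -> infratype X p C ->
  (forall j x, B j x -> `|x| <= r j) -> (forall j k, B j (a j k)) ->
  exists2 c : J -> X, (forall j, B j (c j)) &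
    `|\sum_j c j - \sum_j dyadic_mean (a j)| <=
      C * (\sum_j r j `^ p) `^ p^-1 * \sum_(l < m) halving_ratio R p ^+ l.
Proof.
move=> p_gt1 C_gt0 X_infratype le_r.
have p_gt0 : 0 < p by apply: lt_trans p_gt1.
elim: m a => [|m IHm] a Ba.
  exists (a^~ tt) => // ; rewrite big_ord0 mulr0 -sumrB big1 ?normr0// => j _.
  by rewrite /dyadic_mean scale1r (big_pred1 tt) ?subrr// => -[].
(* Each pair of points carries its own sign: one sign for each set would not
   make the errors decrease with [m]. *)
have [c le_c] := @infratype_select R X p C (J * dyadic_index m)%type
  (fun z => 2^-1 ^+ m *: a z.1 (true, z.2))
  (fun z => 2^-1 ^+ m *: a z.1 (false, z.2)) X_infratype.
pose a' j k := a j (c (j, k), k).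
have [c' Bc' le_c'] := IHm a' (fun j k => Ba j _).
exists c' => //; rewrite big_ord_recr/= mulrDr.
rewrite -[X in `|X|](subrKA (\sum_j dyadic_mean (a' j))).
apply: le_trans (ler_normD _ _) (lerD le_c' _).
have -> : \sum_j dyadic_mean (a' j) =
    \sum_(z : J * dyadic_index m) (if c z then 2^-1 ^+ m *: a z.1 (true, z.2)
       else 2^-1 ^+ m *: a z.1 (false, z.2)).
  rewrite sum_pair.
  apply: eq_bigr => j _; rewrite /dyadic_mean scaler_sumr.
  by apply: eq_bigr => k _; rewrite /a'; case: (c _).
have -> : \sum_j dyadic_mean (a j) = 2^-1 *: \sum_(z : J * dyadic_index m)
    (2^-1 ^+ m *: a z.1 (true, z.2) + 2^-1 ^+ m *: a z.1 (false, z.2)).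
  rewrite sum_pair scaler_sumr.
  apply: eq_bigr => j _; rewrite dyadic_meanS /dyadic_mean !scaler_sumr.
  by rewrite -big_split scaler_sumr.
apply: le_trans le_c _; rewrite -mulrA ler_pM2l//.
rewrite [leRHS]mulrC -halving_ratio_expE ?sumr_ge0// => [|j _]; last first.
  exact: powR_ge0.
have r_ge0 (j : J) (k : dyadic_index m) : 0 <= r j.
  exact: le_trans (le_r _ _ (Ba j (true, k))).
apply: ge0_ler_powR; rewrite ?nnegrE ?invr_ge0 ?(ltW p_gt0)//.
- by rewrite sumr_ge0// => ? _; rewrite powR_ge0.
- rewrite !mulr_ge0 ?exprn_ge0 ?powR_ge0 ?sumr_ge0// => ? _.
  by rewrite powR_ge0.
rewrite sum_pair mulr_sumr; apply: ler_sum => j _.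
have -> : 2 ^+ m * (2^-1 ^+ m) `^ p * r j `^ p =
    \sum_(k : dyadic_index m) (2^-1 ^+ m * r j) `^ p.
  transitivity (\sum_(k : dyadic_index m) ((2^-1 ^+ m) `^ p * r j `^ p)).
    by rewrite sumr_const card_dyadic_index -[RHS]mulr_natl natrX mulrA.
  by apply: eq_bigr => k _; rewrite powRM ?exprn_ge0 ?(r_ge0 j k).
apply: ler_sum => k _.
apply: ge0_ler_powR; rewrite ?nnegrE ?mulr_ge0 ?exprn_ge0 ?(r_ge0 j k)//.
  exact: ltW.
rewrite -scalerBr scalerA mulrC -scalerA normrZ ger0_norm ?exprn_ge0//.
rewrite ler_wpM2l ?exprn_ge0// normrZ ger0_norm ?invr_ge0//.
rewrite ler_pdivrMl// mulr_natl mulr2n.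
by apply: le_trans (ler_normB _ _) (lerD _ _); apply: le_r.
Qed.

(** * Approximating convex hulls by dyadic means *)

Lemma convex_setP (R : realType) (X : lmodType R) (A : set X) :
  convex_set A <-> forall (x y : X) (t : R), 0 <= t <= 1 ->
    A x -> A y -> A (t *: x + (1 - t) *: y).
Proof.
split=> [cA x y t /andP[t0 t1] Ax Ay|cA x y t /set_mem Ax /set_mem Ay].
  by have /set_mem := cA x y (Itv01 t0 t1) (mem_set Ax) (mem_set Ay).
by apply/mem_set/cA => //; rewrite ge0 le1.
Qed.

Lemma norm_convex_le (R : realType) (X : normedModType R) (x y : X) (t M : R) :
  0 <= t <= 1 -> `|x| <= M -> `|y| <= M -> `|t *: x + (1 - t) *: y| <= M.
Proof.
move=> /andP[t0 t1] xM yM; apply: le_trans (ler_normD _ _) _.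
rewrite !normrZ !ger0_norm ?subr_ge0//.
have -> : M = t * M + (1 - t) * M by ring.
by rewrite lerD// ler_wpM2l// subr_ge0.
Qed.

Lemma conv_hull_le_norm (R : realType) (X : normedModType R) (B : set X) M :
  (forall x, B x -> `|x| <= M) -> forall x, conv_hull B x -> `|x| <= M.
Proof.
move=> BM x; apply: (smallest_sub (X := [set x : X | `|x| <= M])) => //.
apply/convex_setP => {}x y t t01 /= xM yM.
exact: norm_convex_le.
Qed.

Lemma conv_hull_scale (R : realType) (X : lmodType R) (B : set X) (l : R) x :
  conv_hull B x -> conv_hull (set_scale l B) (l *: x).
Proof.
move=> Bx M [cM sM].
have : [set y | M (l *: y)] x; last by [].
apply: Bx; split => [|y By]; last by apply: sM; exists y.
apply/convex_setP => {}x y t t01 /= Mx My.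
by rewrite scalerDr !scalerA !(mulrC l) -!scalerA; move/convex_setP : cM; apply.
Qed.

Lemma midpointxx (R : realType) (X : lmodType R) (x : X) : 2^-1 *: (x + x) = x.
Proof.
rewrite scalerDr -scalerDl -[RHS]scale1r; congr (_ *: _); by field.
Qed.

Lemma dyadic_mean_raise (R : realType) (X : lmodType R) (B : set X) m n
    (a : dyadic_index m -> X) : (m <= n)%N -> (forall k, B (a k)) ->
  exists2 b : dyadic_index n -> X, (forall k, B (b k)) &
    dyadic_mean b = dyadic_mean a.
Proof.
move=> /subnK <-; elim: (n - m)%N => [|d IHd] Ba; first by exists a.
have [b Bb <-] := IHd Ba.
exists (fun k : dyadic_index (d + m).+1 => b k.2) => //.
by rewrite dyadic_meanS midpointxx.
Qed.

Definition dyadic_means {R : realType} {X : lmodType R} (B : set X) : set X :=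
  [set x | exists m (a : dyadic_index m -> X),
     (forall k, B (a k)) /\ dyadic_mean a = x].

Lemma dyadic_means_midpoint (R : realType) (X : lmodType R) (B : set X) x y :
  dyadic_means B x -> dyadic_means B y -> dyadic_means B (2^-1 *: (x + y)).
Proof.
move=> [m [a [Ba <-]]] [n [b [Bb <-]]].
have [a' Ba' <-] := dyadic_mean_raise R X B m (maxn m n) a (leq_maxl m n) Ba.
have [b' Bb' <-] := dyadic_mean_raise R X B n (maxn m n) b (leq_maxr m n) Bb.
exists (maxn m n).+1; exists (fun k => if k.1 then a' k.2 else b' k.2).
by split=> [[[] k]|]//=; rewrite dyadic_meanS.
Qed.

(** Bisection: a point of the half of the segment next to [y] is the midpoint of
    [y] and a point of the segment, so that an approximation of the latter
    yields one of the former with half the error. *)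
Lemma midpoint_segment_approx (R : realType) (X : normedModType R) (D : set X) :
  (forall x y, D x -> D y -> D (2^-1 *: (x + y))) ->
  forall n (x y : X) (t : R), 0 <= t <= 1 -> D x -> D y ->
  exists2 z, D z & `|t *: x + (1 - t) *: y - z| <= 2^-1 ^+ n * `|x - y|.
Proof.
move=> mD; elim=> [|n IHn] x y t /andP[t0 t1] Dx Dy.
  exists y => //; rewrite expr0 mul1r scalerBl scale1r addrCA addrC addrK.
  by rewrite -scalerBr normrZ ger0_norm// ler_piMl.
wlog t2 : x y t t0 t1 Dx Dy / t <= 2^-1 => [wlog_t2|].
  have [/wlog_t2|t2] := leP t 2^-1; first exact.
  have [|||||z Dz] := wlog_t2 y x (1 - t); rewrite ?subr_ge0//.
  - by rewrite gerBl.
  - by lra.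
  by rewrite subKr [X in X - z]addrC (distrC y) => le_z; exists z.
have [|//|//|z Dz le_z] := IHn x y (2 * t); first by apply/andP; split; lra.
exists (2^-1 *: (z + y)); first exact: mD.
rewrite exprS -mulrA.
have -> : t *: x + (1 - t) *: y - 2^-1 *: (z + y) =
    2^-1 *: ((2 * t) *: x + (1 - 2 * t) *: y - z).
  rewrite !(scalerDr, scalerN, scalerA) mulrA mulVf// mul1r opprD.
  rewrite !addrA addrAC; congr (_ - _); rewrite -addrA -scaleNr -scalerDl.
  by congr (_ + _ *: _); field.
by rewrite normrZ ger0_norm// ler_pM2l.
Qed.

(** The points that can be approximated by dyadic means of points of [B] form a
    convex set, as dyadic means are closed under midpoints. *)
Lemma conv_hull_dyadic_means (R : realType) (X : normedModType R)
    (B : set X) x :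
  conv_hull B x ->
  forall e, 0 < e -> exists2 z, dyadic_means B z & `|x - z| <= e.
Proof.
move: x; apply: smallest_sub => [|x Bx e e0]; last first.
  exists x; last by rewrite subrr normr0 ltW.
  exists 0%N, (fun=> x); split=> //.
  by rewrite /dyadic_mean expr0 scale1r (big_pred1 tt)// => -[].
apply/convex_setP => x y t t01 Dx Dy e e0 /=.
have e4 : 0 < e / 2 by rewrite divr_gt0.
have [x' Dx' le_x] := Dx _ e4; have [y' Dy' le_y] := Dy _ e4.
have [n le_n] : exists n, 2^-1 ^+ n * `|x' - y'| <= e / 2.
  have [n _ /(_ n (leqnn n)) le_n] := near_infty_natSinv_expn_lt
    (PosNum (divr_gt0 e4 (ltr_pwDl ltr01 (normr_ge0 (x' - y'))))).
  exists n; move: le_n => /=; rewrite div1r -exprVn => /ltW le_n.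
  apply: (@le_trans _ _ (2^-1 ^+ n * (1 + `|x' - y'|))).
    by rewrite ler_wpM2l ?exprn_ge0// lerDr.
  by rewrite -ler_pdivlMr// ltr_pwDl.
have [z Dz le_z] := midpoint_segment_approx R X _ (dyadic_means_midpoint R X B)
  n _ _ _ t01 Dx' Dy'.
exists z => //.
have -> : t *: x + (1 - t) *: y - z =
    (t *: (x - x') + (1 - t) *: (y - y')) + (t *: x' + (1 - t) *: y' - z).
  by rewrite !scalerBr [X in _ = X + _]addrACA -opprD subrKA.
apply: le_trans (ler_normD _ _) _; rewrite [leRHS]splitr.
by apply: lerD (le_trans le_z le_n); apply: norm_convex_le.
Qed.

(** Approximate the points of the convex hulls by dyadic means, raise these to a
    common depth and round them; the geometric series of the errors does not
    depend on that depth. *)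
Lemma round_conv_hull (R : realType) (X : normedModType R) (p C : R)
    (J : finType) (B : J -> set X) (r : J -> R) (y : J -> X) (e : R) :
  1 < p -> 0 < C -> infratype X p C ->
  (forall j x, B j x -> `|x| <= r j) -> (forall j, conv_hull (B j) (y j)) ->
  0 < e ->
  exists2 c : J -> X, (forall j, B j (c j)) &
    `|\sum_j c j - \sum_j y j| <=
      C / (1 - halving_ratio R p) * (\sum_j r j `^ p) `^ p^-1 + e.
Proof.
move=> p_gt1 C_gt0 X_it le_r By e0.
pose e' := e / (#|J|.+1)%:R.
have e'0 : 0 < e' by rewrite divr_gt0.
have /choice[m mP] (j : J) : exists m, exists2 a : dyadic_index m -> X,
    (forall k, B j (a k)) & `|y j - dyadic_mean a| <= e'.
  have [_ [m [a [Ba <-]]] le_a] := conv_hull_dyadic_means _ _ _ _ (By j) _ e'0.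
  by exists m, a.
pose M := \max_j m j.
have /choice[a aP] (j : J) : exists a : dyadic_index M -> X,
    (forall k, B j (a k)) /\ `|y j - dyadic_mean a| <= e'.
  have [a Ba le_a] := mP j.
  have [b Bb Eb] :=
    dyadic_mean_raise _ _ _ _ _ a (leq_bigmax j : (m j <= M)%N) Ba.
  by exists b; rewrite Eb.
have [c Bc le_c] := round_dyadic R X p C J B r M a p_gt1 C_gt0 X_it le_r
  (fun j => (aP j).1).
exists c => //; rewrite -(subrKA (\sum_j dyadic_mean (a j))).
apply: le_trans (ler_normD _ _) (lerD (le_trans le_c _) _).
  rewrite -[leRHS]mulrA [in leRHS]mulrCA [leRHS]mulrC.
  rewrite ler_wpM2l ?mulr_ge0 ?powR_ge0 ?(ltW C_gt0)//.
  have q1 : 0 < 1 - halving_ratio R p by rewrite subr_gt0 halving_ratio_lt1.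
  rewrite -[leRHS]mul1r ler_pdivlMr// mulrC -opprB mulNr -subrX1 opprB.
  by rewrite gerBl exprn_ge0// halving_ratio_ge0.
rewrite -sumrB; apply: le_trans (ler_norm_sum _ _ _) _.
apply: (@le_trans _ _ (\sum_(j : J) e')).
  by apply: ler_sum => j _; rewrite distrC (aP j).2.
rewrite sumr_const -[leLHS]mulr_natr /e' mulrAC ler_pdivrMr//.
by rewrite ler_wpM2l ?(ltW e0)// ler_nat.
Qed.
(** * Hausdorff distance and Minkowski sums *)

Lemma in_bP (R : realType) (X : normedModType R) (A : set X) :
  in_b A <-> A !=set0 /\ exists M, forall x, A x -> `|x| <= M.
Proof.
split=> -[[a Aa] bA]; (split; first by exists a);
  have bndP := @ex_bound _ _ _ (fun x : X => x) _ (globally_properfilter Aa).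
  by have [/(_ bA)] := bndP.
by have [_ /(_ bA)] := bndP.
Qed.

Lemma dist_set_le (R : realType) (X : normedModType R) (A : set X) (x a : X) :
  A a -> dist_set x A <= `|x - a|.
Proof.
by move=> Aa; apply: ge_inf; [exists 0 => _ [b _ <-] | exists a].
Qed.

Lemma dist_set_lt (R : realType) (X : normedModType R) (A : set X) (x : X) e :
  A !=set0 -> dist_set x A < e -> exists2 a, A a & `|x - a| < e.
Proof.
move=> [a Aa] /inf_lt[|_ [b Ab <-]]; first by exists `|x - a|, a.
by exists b.
Qed.

(** Boundedness of [A] makes the supremum a genuine upper bound. *)
Lemma sup_dist_set_lt (R : realType) (X : normedModType R) (A B : set X) e :
  in_b A -> B !=set0 -> sup [set dist_set a B | a in A] < e ->
  forall a, A a -> exists2 b, B b & `|a - b| < e.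
Proof.
move=> /in_bP[_ [M AM]] [b Bb] lt_e a Aa.
apply: dist_set_lt; first by exists b.
apply: le_lt_trans lt_e; apply: ub_le_sup; last by exists a.
exists (M + `|b|) => _ [x Ax <-].
apply: le_trans (dist_set_le _ _ _ _ _ Bb) (le_trans (ler_normB _ _) _).
by rewrite lerD2r AM.
Qed.

Lemma hausdorff_lt (R : realType) (X : normedModType R) (A B : set X) e :
  in_b A -> in_b B -> hausdorff A B < e ->
  (forall a, A a -> exists2 b, B b & `|a - b| < e) /\
  (forall b, B b -> exists2 a, A a & `|b - a| < e).
Proof.
move=> bA bB; rewrite /hausdorff gt_max => /andP[ltB ltA].
by split; apply: sup_dist_set_lt => //; [case: bB | case: bA].
Qed.

Lemma hausdorff_le (R : realType) (X : normedModType R) (A B : set X) e :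
  A !=set0 -> B !=set0 ->
  (forall a, A a -> exists2 b, B b & `|a - b| <= e) ->
  (forall b, B b -> exists2 a, A a & `|b - a| <= e) ->
  hausdorff A B <= e.
Proof.
move=> [a Aa] [b Bb] AB BA; rewrite /hausdorff ge_max; apply/andP; split.
  apply: ge_sup => [|_ [y By <-]]; first by exists (dist_set b A), b.
  by have [x Ax] := BA _ By; apply: le_trans; apply: dist_set_le.
apply: ge_sup => [|_ [x Ax <-]]; first by exists (dist_set a B), a.
by have [y By] := AB _ Ax; apply: le_trans; apply: dist_set_le.
Qed.

Lemma minkowski_sumP (X : zmodType) n (G : 'I_n -> set X) (s : X) :
  (\big[@minkowski_add X/[set 0]]_(i < n) G i) s <->
  exists2 f : 'I_n -> X, (forall i, G i (f i)) & \sum_i f i = s.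
Proof.
elim: n G s => [|n IHn] G s.
  rewrite big_ord0; split=> [->|[f _]]; last by rewrite big_ord0.
  by exists (fun=> 0) => [[]//|]; rewrite big_ord0.
rewrite big_ord_recl; split=> [[a Ga [b /IHn[f Gf <-] <-]]|[f Gf <-]].
  exists (fun i => oapp f a (unlift ord0 i)) => [i|].
    by case: unliftP => [j|] ->.
  by rewrite big_ord_recl unlift_none; under eq_bigr do rewrite liftK.
rewrite big_ord_recl; exists (f ord0) => //.
exists (\sum_(i < n) f (lift ord0 i)) => //.
by apply/IHn; exists (fun i => f (lift ord0 i)).
Qed.

Lemma riemann_sumP (R : realType) (X : normedModType R) (F : R -> set X)
    (T : tagged_partition R) (s : X) :
  riemann_sum F T s <->
  exists2 f : 'I_(size (tp_seq T)) -> X, (forall i, F (tp_tag i) (f i)) &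
    \sum_i tp_length i *: f i = s.
Proof.
split=> [/minkowski_sumP[g Gg <-]|[f Ff <-]].
  have /choice[f fP] i : exists x, F (tp_tag i) x /\ tp_length i *: x = g i.
    by have [x Fx <-] := Gg i; exists x.
  exists f => [i|]; first exact: (fP i).1.
  by apply: eq_bigr => i _; apply: (fP i).2.
apply/minkowski_sumP; exists (fun i => tp_length i *: f i) => // i.
by exists (f i).
Qed.

(** * Tagged partitions and Riemann sums *)

Section TaggedPartition.
Context {R : realType} (T : tagged_partition R).
Let n := size (tp_seq T).

Lemma tp_length_gt0 (i : 'I_n) : 0 < tp_length i.
Proof.
have [/(pathP 0) /(_ i (ltn_ord i)) lt_i _] := tp_seqP T.
by rewrite subr_gt0.
Qed.

Lemma tp_length_le_mesh (i : 'I_n) : tp_length i <= tp_mesh T.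
Proof. by rewrite /tp_mesh (bigD1 i)//= le_max lexx. Qed.

Lemma tp_mesh_ge0 : 0 <= tp_mesh T.
Proof.
rewrite /tp_mesh; elim/big_ind: _ => // [x y x0 y0|i _].
  by rewrite le_max x0.
by rewrite ltW// tp_length_gt0.
Qed.

Lemma sum_tp_length : \sum_(i < n) tp_length i = 1.
Proof.
rewrite -(big_mkord xpredT
  (fun i => tp_point (tp_seq T) i.+1 - tp_point (tp_seq T) i)).
rewrite telescope_sumr// /tp_point subr0 (nth_last 0 (0 :: _)).
by case: (tp_seqP T) => _ /eqP.
Qed.

Lemma tp_tag01 (i : 'I_n) : 0 <= tp_tag i <= 1.
Proof.
have [lt_s /eqP last_s] := tp_seqP T.
have le_s : sorted <=%R (0 :: tp_seq T) by apply: sub_path lt_s => x y /ltW.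
have nth_le := sorted_leq_nth le_trans lexx 0 le_s.
have [/andP[le_t t_le] i_n] := (tp_tagP i, ltn_ord i).
apply/andP; split.
  apply: le_trans le_t; apply: (nth_le 0%N); rewrite ?inE//=.
  exact: ltnW.
apply: le_trans t_le _; rewrite -last_s -[leRHS]/(last 0 (0 :: _)) -nth_last.
apply: (nth_le i.+1); rewrite ?inE//=.
Qed.

(** In [l ^ p = l * l ^ (p - 1)], for a length [l], the second factor is bounded
    by the power of the mesh, as [p > 1], while the first ones add up to the
    length of the unit interval. This is where the errors become small for fine
    partitions. *)
Lemma tp_pnorm_le (p K : R) : 1 < p -> 0 <= K ->
  (\sum_(i < n) (tp_length i * K) `^ p) `^ p^-1 <=
    tp_mesh T `^ ((p - 1) / p) * K.
Proof.
move=> p1 K0; have p0 : 0 < p by apply: lt_trans p1.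
have m0 := tp_mesh_ge0.
have -> : tp_mesh T `^ ((p - 1) / p) * K =
    (tp_mesh T `^ (p - 1) * K `^ p) `^ p^-1.
  by rewrite powRM ?powR_ge0// -!powRrM mulfV ?gt_eqF// powRr1.
apply: ge0_ler_powR; rewrite ?nnegrE ?invr_ge0 ?(ltW p0)//.
- by rewrite sumr_ge0// => i _; rewrite powR_ge0.
- by rewrite mulr_ge0 ?powR_ge0.
rewrite -[leRHS]mul1r -[X in _ <= X * _]sum_tp_length mulr_suml.
apply: ler_sum => i _.
rewrite powRM ?(ltW (tp_length_gt0 _))// mulrA ler_wpM2r ?powR_ge0//.
rewrite -mulr_powRB1 ?(ltW (tp_length_gt0 _))// ler_pM2l ?tp_length_gt0//.
apply: ge0_ler_powR; rewrite ?nnegrE//.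
- by rewrite subr_ge0 ltW.
- exact/ltW/tp_length_gt0.
exact: tp_length_le_mesh.
Qed.

End TaggedPartition.

Lemma riemann_sum_subset (R : realType) (X : normedModType R)
    (F G : R -> set X) (T : tagged_partition R) :
  (forall t, F t `<=` G t) -> riemann_sum F T `<=` riemann_sum G T.
Proof.
move=> FG s /riemann_sumP[f Ff <-]; apply/riemann_sumP.
by exists f => // i; apply: FG.
Qed.

Lemma riemann_sum_in_b (R : realType) (X : normedModType R) (F : R -> set X)
    (T : tagged_partition R) :
  (forall t, 0 <= t <= 1 -> in_b (F t)) -> in_b (riemann_sum F T).
Proof.
move=> bF; apply/in_bP; split.
  have /choice[f Ff] (i : 'I_(size (tp_seq T))) : exists x, F (tp_tag i) x.
    by have [] := bF _ (tp_tag01 T i).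
  by exists (\sum_i tp_length i *: f i); apply/riemann_sumP; exists f.
have /choice[M MP] (i : 'I_(size (tp_seq T))) : exists M, forall x,
    F (tp_tag i) x -> `|x| <= M.
  by have /in_bP[] := bF _ (tp_tag01 T i).
exists (\sum_i tp_length i * M i) => _ /riemann_sumP[f Ff <-].
apply: le_trans (ler_norm_sum _ _ _) _; apply: ler_sum => i _.
have l0 := ltW (tp_length_gt0 T i).
by rewrite normrZ ger0_norm// ler_wpM2l//; apply: MP.
Qed.

(** Rounding with the sets [|Delta_i| F(t_i)], whose radii are [|Delta_i| K]. *)
Lemma riemann_sum_conv_approx (R : realType) (X : normedModType R) (p C K : R)
    (F : R -> set X) (T : tagged_partition R) (s : X) (e : R) :
  1 < p -> 0 < C -> infratype X p C -> 0 <= K ->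
  (forall t, 0 <= t <= 1 -> forall x, F t x -> `|x| <= K) -> 0 < e ->
  riemann_sum (fun t => conv_hull (F t)) T s ->
  exists2 s', riemann_sum F T s' &
    `|s - s'| <=
      C / (1 - halving_ratio R p) * (tp_mesh T `^ ((p - 1) / p) * K) + e.
Proof.
move=> p1 C0 Xit K0 FK e0 /riemann_sumP[y Fy <-].
have [||c Fc le_c] := round_conv_hull R X p C _
  (fun i : 'I_(size (tp_seq T)) => set_scale (tp_length i) (F (tp_tag i)))
  (fun i => tp_length i * K) (fun i => tp_length i *: y i) e p1 C0 Xit _ _ e0.
- move=> i _ [x Fx <-]; have l0 := ltW (tp_length_gt0 T i).
  by rewrite normrZ ger0_norm// ler_wpM2l// (FK _ (tp_tag01 T i)).
- by move=> i; apply: conv_hull_scale.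
exists (\sum_i c i); first by apply/minkowski_sumP; exists c.
rewrite distrC; apply: le_trans le_c _; rewrite lerD2r ler_wpM2l//.
  by rewrite divr_ge0 ?(ltW C0)// subr_ge0 ltW// halving_ratio_lt1.
exact: tp_pnorm_le.
Qed.
Lemma consecutive_bracket (R : realType) (h : nat -> R) n t :
  h 0%N <= t <= h n.+1 -> exists2 i, (i < n.+1)%N & h i <= t <= h i.+1.
Proof.
elim: n => [|n IHn] /andP[h0 hn]; first by exists 0%N => //; rewrite h0.
have [th|/ltW ht] := leP t (h n.+1); last by exists n.+1 => //; rewrite ht.
by have [|i /ltnW i_n hi] := IHn; [rewrite h0 | exists i].
Qed.

Lemma uniform_tagged_partition (R : realType) (d : R) : 0 < d ->
  exists s : seq R, exists l : R, [/\ itv_partition 0 1 s, (0 < size s)%N,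
    0 < l < d & forall i, (i <= size s)%N -> tp_point s i = i%:R * l].
Proof.
move=> d0; have [n lt_n] : exists n, n.+1%:R^-1 < d.
  by have [n _ /(_ n (leqnn n))] := near_infty_natSinv_lt (PosNum d0); exists n.
pose l := n.+1%:R^-1 : R.
have l0 : 0 < l by rewrite invr_gt0.
pose s := mkseq (fun i => i.+1%:R * l) n.+1.
have sz : size s = n.+1 by rewrite size_mkseq.
have pt i : (i <= size s)%N -> tp_point s i = i%:R * l.
  case: i => [|i]; first by rewrite mul0r.
  by rewrite sz => i_n; rewrite /tp_point /= nth_mkseq.
exists s, l; split; rewrite ?sz ?l0//; last by rewrite -sz.
split.
  apply/(pathP 0) => i i_s.
  have := pt i.+1 i_s; have := pt i (ltnW i_s).
  by rewrite /tp_point => -> /= ->; rewrite ltr_pM2r// ltr_nat.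
have <- : tp_point s n.+1 = 1 by rewrite pt ?sz// mulfV.
by rewrite /tp_point -sz -[size s]/(size (0 :: s)).-1 nth_last.
Qed.

(** Fix a uniform partition. Moving a single tag from the left endpoint of its
    interval to [t] changes a Riemann sum by the length of the interval
    times the difference of a point of [F t] and a fixed point, so that
    bounded Riemann sums bound [F t]. *)
Lemma riemann_sums_bounded (R : realType) (X : normedModType R)
    (F : R -> set X) (d M : R) : 0 < d ->
  (forall t, 0 <= t <= 1 -> F t !=set0) ->
  (forall T : tagged_partition R, tp_mesh T < d ->
    forall s, riemann_sum F T s -> `|s| <= M) ->
  exists K, forall t : R, 0 <= t <= 1 -> forall x, F t x -> `|x| <= K.
Proof.
move=> d0 F0 le_M.
have [s [l [sP s_gt0 /andP[l0 ld] s_pt]]] := uniform_tagged_partition R d d0.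
have s_len (i : 'I_(size s)) : tp_point s i.+1 - tp_point s i = l.
  by rewrite !s_pt// 1?ltnW// -mulrBl -natrB// subSnn mul1r.
have s_le (i : 'I_(size s)) : tp_point s i <= tp_point s i.+1.
  by rewrite -subr_ge0 s_len ltW.
have baseP (i : 'I_(size s)) :
  tp_point s i <= tp_point s i <= tp_point s i.+1 by rewrite lexx s_le.
pose T0 := @TaggedPartition R s (fun i => tp_point s i) sP baseP.
have /choice[f0 Ff0] (i : 'I_(size s)) : exists x, F (tp_point s i) x.
  exact: F0 (tp_tag01 T0 i).
have mesh_lt (tag : 'I_(size s) -> R) tagP :
    tp_mesh (@TaggedPartition R s tag sP tagP) < d.
  by apply: bigmax_lt => // i _; rewrite /tp_length s_len.
exists (\sum_i `|f0 i| + 2 * M / l) => t t01 x Fx.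
have [i0 ti0] : exists i : 'I_(size s), tp_point s i <= t <= tp_point s i.+1.
  have [] := consecutive_bracket R (tp_point s) (size s).-1 t.
    have [_ /eqP last_s] := sP.
    by rewrite prednK// /tp_point (nth_last 0 (0 :: s)) /= last_s.
  by rewrite prednK// => i i_s ti; exists (Ordinal i_s).
(* [t] may belong to two intervals when it is a division point, so the interval
   to retag is singled out by its index. *)
pose tag i := if i == i0 then t else tp_point s i.
have tagP (i : 'I_(size s)) : tp_point s i <= tag i <= tp_point s i.+1.
  by rewrite /tag; case: eqP => [->|_].
pose f i := if i == i0 then x else f0 i.
have Sf0 : riemann_sum F T0 (\sum_i l *: f0 i).
  apply/riemann_sumP; exists f0 => //.
  by apply: eq_bigr => i _; rewrite /tp_length s_len.
have Sf : riemann_sum F (@TaggedPartition R s tag sP tagP) (\sum_i l *: f i).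
  apply/riemann_sumP; exists f => [i|].
    by rewrite /f /= /tag; case: eqP.
  by apply: eq_bigr => i _; rewrite /tp_length s_len.
have le_d : `|l *: (x - f0 i0)| <= 2 * M.
  have -> : l *: (x - f0 i0) = \sum_i l *: f i - \sum_i l *: f0 i.
    rewrite -sumrB (bigD1 i0)//= big1 => [|i /negPf ne]; last first.
      by rewrite /f ne subrr.
    by rewrite addr0 /f eqxx scalerBr.
  rewrite mulr_natl mulr2n; apply: le_trans (ler_normB _ _) _.
  apply: lerD; first exact: le_M (mesh_lt _ _) _ Sf.
  exact: le_M (mesh_lt _ _) _ Sf0.
rewrite -[x](subrK (f0 i0)) addrC.
apply: le_trans (ler_normD _ _) (lerD _ _).
  by rewrite (bigD1 i0)//= lerDl sumr_ge0.
by rewrite ler_pdivlMr// mulrC -(gtr0_norm l0) -normrZ.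
Qed.

Lemma powR_small (R : realType) (a c e : R) : 0 < a -> 0 <= c -> 0 < e ->
  exists2 d, 0 < d & forall x, 0 <= x < d -> c * x `^ a <= e.
Proof.
move=> a0 c0 e0; have c1 : 0 < c + 1 by rewrite ltr_pwDr.
exists ((e / (c + 1)) `^ a^-1) => [|x /andP[x0 /ltW xd]].
  by rewrite powR_gt0// divr_gt0.
apply: (@le_trans _ _ ((c + 1) * x `^ a)).
  by rewrite ler_wpM2r ?powR_ge0// lerDl.
rewrite mulrC -ler_pdivlMr//.
have -> : e / (c + 1) = ((e / (c + 1)) `^ a^-1) `^ a.
  by rewrite -powRrM mulVf ?gt_eqF// powRr1// divr_ge0 ?ltW.
by apply: ge0_ler_powR; rewrite ?nnegrE ?powR_ge0 ?(ltW a0).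
Qed.

(** * Integrability *)

Theorem theorem3p5 (R : realType) (X : completeNormedModType R) (p C : R)
  (p_gt1 : 1 < p) (C_gt0 : 0 < C) (X_infratype : infratype X p C)
  (F : R -> set X) (F_b : forall t : R, 0 <= t <= 1 -> in_b (F t))
  (A : set X)
  (convF_A : is_riemann_integral (fun t => conv_hull (F t)) A) :
  is_riemann_integral F A.
Proof.
have [clb_A conv_lim] := convF_A; have [b_A _] := clb_A.
have /in_bP[A0 [MA leA]] := b_A.
have F_conv t : F t `<=` conv_hull (F t) by apply: sub_gen_smallest.
have conv_b (t : R) : 0 <= t <= 1 -> in_b (conv_hull (F t)).
  move=> /F_b/in_bP[[x Fx] [M FM]]; apply/in_bP; split.
    by exists x; apply: F_conv.
  by exists M => y; apply: conv_hull_le_norm.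
(* Fine Riemann sums of [conv F] are within 1 of [A], hence bounded. *)
have [K FK] :
    exists K, forall t : R, 0 <= t <= 1 -> forall x, F t x -> `|x| <= K.
  have [d d0 lim_d] := conv_lim 1 ltr01.
  apply: (riemann_sums_bounded R X F d (1 + MA) d0) => [t /F_b[]//|T Td s Fs].
  have [SA _] := hausdorff_lt R X _ _ _ (riemann_sum_in_b R X _ T conv_b) b_A
    (lim_d T Td).
  have [a Aa lt_a] := SA s (riemann_sum_subset R X _ _ T F_conv s Fs).
  rewrite -[s](subrK a); apply: le_trans (ler_normD _ _) (lerD (ltW lt_a) _).
  exact: leA.
have K0 : 0 <= K.
  have t0 : 0 <= (0 : R) <= 1 by rewrite lexx ler01.
  by have [[x Fx] _] := F_b 0 t0; apply: le_trans (FK 0 t0 x Fx).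
split=> // e e0.
have e2 : 0 < e / 2 by rewrite divr_gt0.
have e8 : 0 < e / 8 by rewrite divr_gt0.
have [d1 d1_gt0 lim_d1] := conv_lim _ e2.
pose c := C / (1 - halving_ratio R p) * K.
have c_ge0 : 0 <= c.
  rewrite mulr_ge0// divr_ge0 ?(ltW C_gt0)// subr_ge0 ltW//.
  exact: halving_ratio_lt1.
have p'_gt0 : 0 < (p - 1) / p.
  by rewrite divr_gt0 ?subr_gt0// (lt_trans ltr01).
have [d2 d2_gt0 small_d2] := powR_small R _ c _ p'_gt0 c_ge0 e8.
exists (Num.min d1 d2) => [|T]; first by rewrite lt_min d1_gt0.
rewrite lt_min => /andP[T1 T2].
have [SA AS] := hausdorff_lt R X _ _ _ (riemann_sum_in_b R X _ T conv_b) b_A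
  (lim_d1 T T1).
(* [e / 2] from the sums of [conv F] to [A], [e / 4] from these to the sums of
   [F]: [e / 8] for the power of the mesh and [e / 8] for the approximation
   of the convex hulls. *)
apply: (@le_lt_trans _ _ (e / 2 + e / 4)); last by lra.
apply: hausdorff_le => // [|s Fs|a Aa].
- by have [] := riemann_sum_in_b R X F T F_b.
- have [a Aa /ltW le_a] := SA s (riemann_sum_subset R X _ _ T F_conv s Fs).
  by exists a => //; apply: le_trans le_a _; rewrite lerDl; lra.
have [s Ss /ltW le_s] := AS a Aa.
have [s' Fs' le_s'] := riemann_sum_conv_approx R X p C K F T s (e / 8)
  p_gt1 C_gt0 X_infratype K0 FK e8 Ss.
exists s' => //; rewrite -(subrKA s).
apply: le_trans (ler_normD _ _) (lerD le_s (le_trans le_s' _)).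
have -> : e / 4 = e / 8 + e / 8 by field.
rewrite lerD2r mulrA mulrAC -/c.
by apply: small_d2; rewrite T2 tp_mesh_ge0.
Qed.
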